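(* Let $n,k$ be positive integers with $k\geqslant n$, let $m_1,\ldots,m_n$ be nonnegative integers and $M=m_1+\cdots+m_n$. Then $$\sum_{\substack{k_1+\cdots+k_n=k\\ k_j\geqslant 1}}k_1^{m_1}\cdots k_n^{m_n}\zeta(2k_1)\cdots\zeta(2k_n)=(-1)^n\sum_{l=0}^{\min\{T,k\}}\frac{(2l)!}{B_{2l}}\left(\sum_{j=1}^{M+n-2l}\frac{a_{jl}}{2^{M+n-j-1}}(k-l)^{j-1}\right)\zeta(2l)\zeta(2k-2l),$$ where $T=\max\{[(M+n-2)/2],[(n-1)/2]\}$ and $a_{jl}$ are the rational numbers defined in the context.
   Context: $\zeta$ is the Riemann zeta function, with $\zeta(0)=-\frac12$. $B_i$ are the Bernoulli numbers, $\sum_{i\geqslant0}\frac{B_i}{i!}t^i=\frac{t}{e^t-1}$; $[x]$ is the greatest integer not exceeding $x$. The polynomials $f_{mi}(t)\in\mathbb{Q}[t]$ ($m\geqslant 0$, $0\leqslant i\leqslant m+1$) are defined by $f_{00}(t)=\frac12 t-1$, $f_{01}(t)=1$ and, for $m\geqslant 1$: $f_{m0}(t)=tf_{m-1,0}'(t)$; $f_{m,m+1}(t)=-mf_{m-1,m}(t)$; $f_{mi}(t)=tf'_{m-1,i}(t)+i(1-t)f_{m-1,i}(t)-(i-1)f_{m-1,i-1}(t)$ for $1\leqslant i\leqslant m$. For $m\geqslant 0$ let $A_m(t)$ be the $(m+1)\times(m+1)$ lower triangular matrix with entry $f_{ri}(t)$ in row $r$ ($0\leqslant r\leqslant m$),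 column $i$ ($1\leqslant i\leqslant r+1$); it is invertible, and $g_{ri}(t)$ is the entry in row $r$, column $i$ of $A_m(t)^{-1}$ (independent of $m\geqslant r$). Set $f_i(t)=\sum_{i_1+\cdots+i_n=i,\ 0\leqslant i_j\leqslant m_j+1}f_{m_1i_1}(t)\cdots f_{m_ni_n}(t)$ and $F_j(t)=\sum_{i=j}^{M+n}f_i(t)g_{i-1,j}(t)$ for $1\leqslant j\leqslant M+n$; these are even polynomials, and $a_{jl}\in\mathbb{Q}$ denotes the coefficient of $t^{2l}$ in $F_j(t)$. *)

(* Defs.v *)
From HB Require Import structures.
From mathcomp Require Import all_boot all_order all_algebra.
From mathcomp Require Import all_classical all_reals all_analysis.
Set Implicit Arguments.
Unset Strict Implicit.
Unset Printing Implicit Defensive.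
Import Order.TTheory GRing.Theory Num.Theory.
Import numFieldNormedType.Exports.
Local Open Scope ring_scope.

(* Formal power series over rat are represented by their coefficient sequences. *)
Definition fps_mul (u v : nat -> rat) (n : nat) : rat :=
  \sum_(i < n.+1) u i * v (n - i)%N.

Fixpoint fps_inv_seq (u : nat -> rat) (n : nat) : seq rat :=
  if n is m.+1 then
    let s := fps_inv_seq u m in
    rcons s ((u 0%N)^-1 * ((m == 0%N)%:R - \sum_(i < m) s`_i * u (m - i)%N))
  else [::].

Definition fps_inv (u : nat -> rat) (n : nat) : rat := (fps_inv_seq u n.+1)`_n.

(* t / (e^t - 1) is the inverse of (e^t - 1) / t = \sum_n t^n / (n + 1)!;
   see bernoulli_gen for the generating function identity. *)
Definition bernoulli_num (i : nat) : rat :=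
  i`!%:R * fps_inv (fun n => (n.+1`!%:R)^-1) i.

Lemma size_fps_inv_seq u n : size (fps_inv_seq u n) = n.
Proof. by elim: n => //= n IHn; rewrite size_rcons IHn. Qed.

Lemma nth_fps_inv_seq u n i : (i < n)%N -> (fps_inv_seq u n)`_i = fps_inv u i.
Proof.
elim: n => // n IHn; rewrite ltnS leq_eqVlt => /orP[/eqP ->//|lt_in].
by rewrite /= nth_rcons size_fps_inv_seq lt_in IHn.
Qed.

Lemma fps_invP u : u 0%N != 0 ->
  forall n, fps_mul (fps_inv u) u n = (n == 0%N)%:R.
Proof.
move=> u0 n; rewrite /fps_mul big_ord_recr /= subnn.
rewrite {2}/fps_inv /= nth_rcons size_fps_inv_seq ltnn eqxx.
rewrite mulrAC mulVf // mul1r.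
rewrite [X in _ + (_ - X)](eq_bigr (fun i : 'I_n => fps_inv u i * u (n - i)%N)).
  by rewrite addrC subrK.
by move=> i _; rewrite nth_fps_inv_seq.
Qed.

(* (\sum_i B_i / i! t^i) (e^t - 1) = t, coefficientwise *)
Lemma bernoulli_gen n :
  fps_mul (fun i => bernoulli_num i / i`!%:R)
          (fun i => (i`!%:R)^-1 - (i == 0%N)%:R) n = (n == 1%N)%:R.
Proof.
case: n => [|n]; first by rewrite /fps_mul big_ord1 /= invr1 subrr mulr0.
rewrite /fps_mul big_ord_recr /= subnn invr1 subrr mulr0 addr0.
rewrite eqSS -(@fps_invP (fun n => (n.+1`!%:R)^-1)) ?invr1 ?oner_neq0 //.
apply: eq_bigr => i _; rewrite /bernoulli_num [X in X * _ = _]mulrAC divff ?mul1r.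
  by rewrite subSn 1?subr0 // -ltnS.
by rewrite pnatr_eq0 -lt0n fact_gt0.
Qed.

(* The series defining zeta converges only for s > 1, so s = 1 is a junk value;
   the value at 0 is that of the analytic continuation. *)
Definition zeta (R : realType) (s : nat) : R :=
  if s == 0%N then - 2^-1
  else limn (series (fun n : nat => (n.+1%:R ^+ s)^-1 : R)).

(* Zero for i > m + 1. *)
Fixpoint f_ (m i : nat) : {poly rat} :=
  match m with
  | 0 => if i == 0%N then 2^-1 *: 'X - 1 else if i == 1%N then 1 else 0
  | m'.+1 =>
      if i == 0%N then 'X * (f_ m' 0%N)^`()
      else if (i <= m)%N then
        'X * (f_ m' i)^`() + i%:R *: ((1 - 'X) * f_ m' i)
          - (i.-1)%:R *: f_ m' i.-1
      else if i == m.+1 then - (m%:R *: f_ m' m)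
      else 0
  end.

(* Columns are numbered from 1 in the text: column c : 'I_m.+1 holds f_{r,c+1}. *)
Definition Amx (m : nat) : 'M[{poly rat}]_m.+1 :=
  \matrix_(r, c) (if (c <= r)%N then f_ r c.+1 else 0).

(* Entry in row r (from 0) and column i (from 1) of A_m^-1; it does not depend
   on m, see g_indep. *)
Definition g_ (m r i : nat) : {poly rat} := invmx (Amx m) (inord r) (inord i.-1).

Lemma f_diag m : f_ m m.+1 = ((-1) ^+ m * m`!%:R)%:P.
Proof.
elim: m => [|m IHm]; first by rewrite /= mulr1.
have E : f_ m.+1 m.+2 = - (m.+1%:R *: f_ m m.+1) by rewrite /= ltnn eqxx.
rewrite {}E IHm -mul_polyC -polyCM -polyCN factS natrM exprS mulN1r mulNr.
by congr (_%:P); congr (- _); rewrite mulrCA.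
Qed.

Lemma Amx_unit m : Amx m \in unitmx.
Proof.
have tA : is_trig_mx (Amx m).
  by apply/is_trig_mxP => i j lt_ij; rewrite mxE leqNgt lt_ij.
rewrite unitmxE (det_trig tA); apply: rpred_prod => i _.
rewrite mxE leqnn f_diag poly_unitE size_polyC coefC /= unitfE.
rewrite mulf_eq0 signr_eq0 pnatr_eq0 /= -lt0n fact_gt0 /=.
by [].
Qed.

Lemma g_indep m r i : (r <= m)%N -> (0 < i <= r.+1)%N -> g_ m r i = g_ r r i.
Proof.
move=> le_rm; case: i => // i; move=> /= le_ir.
pose P : 'M[{poly rat}]_(r.+1, m.+1) := \matrix_(a, b) ((a == b :> nat)%:R).
have PA : P *m Amx m = Amx r *m P.
  apply/matrixP => a b; rewrite !mxE.
  have lt_am : (a < m.+1)%N by apply: leq_trans (ltn_ord a) _.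
  rewrite (bigD1 (Ordinal lt_am)) //= !mxE eqxx mul1r big1 ?addr0; last first.
    move=> c; rewrite -val_eqE /= eq_sym => /negPf ne_ac.
    by rewrite mxE ne_ac mul0r.
  have [lt_br|le_rb] := ltnP b r.+1.
    rewrite (bigD1 (Ordinal lt_br)) //= !mxE eqxx mulr1 big1 ?addr0 //.
    by move=> c; rewrite -val_eqE /= => /negPf ne; rewrite !mxE ne mulr0.
  rewrite leqNgt (leq_trans (ltn_ord a) le_rb) /= big1 // => c _.
  by rewrite !mxE (ltn_eqF (leq_trans (ltn_ord c) le_rb)) mulr0.
have : P *m invmx (Amx m) = invmx (Amx r) *m P.
  apply: (can_inj (mulKmx (Amx_unit r))).
  by rewrite mulmxA -PA mulKVmx ?Amx_unit // mulmxK ?Amx_unit.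
move/matrixP/(_ (inord r) (inord i)).
have lt_im : (i < m.+1)%N by apply: leq_trans le_ir _.
rewrite !mxE (bigD1 (inord r)) //= !mxE !inordK // eqxx mul1r big1 ?addr0.
  rewrite /g_ /= => ->; rewrite (bigD1 (inord i)) //= !mxE !inordK // eqxx mulr1 big1 ?addr0 //.
  move=> c; rewrite -val_eqE /= inordK // => /negPf ne.
  by rewrite !mxE inordK // ne mulr0.
move=> c; rewrite -val_eqE /= inordK // eq_sym => /negPf ne.
by rewrite !mxE inordK // ne mul0r.
Qed.

Definition fsum (n : nat) (m : 'I_n -> nat) (i : nat) : {poly rat} :=
  \sum_(c : {ffun 'I_n -> 'I_i.+1} |
          (\sum_(j < n) c j == i)%N && [forall j, (c j <= (m j).+1)%N])
     \prod_(j < n) f_ (m j) (c j).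

Definition F_ (n : nat) (m : 'I_n -> nat) (j : nat) : {poly rat} :=
  let N := (\sum_(i < n) m i + n)%N in
  \sum_(j <= i < N.+1) fsum m i * g_ N.-1 i.-1 j.

Definition a_ (n : nat) (m : 'I_n -> nat) (j l : nat) : rat := (F_ m j)`_(2 * l).

(* Main.v *)
(** Put beta_i = B_i / i! and h = t / (e^t - 1) = \sum_i beta_i t^i.

Both sides of the identity are homogeneous of weight 2k, so Euler's formula for
zeta(2i) is needed only up to the value of zeta(2).  In this form it follows by
induction from
  \sum_(0 < j < k) zeta(2j) zeta(2k - 2j) = (k + 1/2) zeta(2k)
and the analogous convolution of the beta_{2i}.  The former comes from the
partial sums: summing a geometric series leaves \sum_n 1 / (n^2 - m^2), which
telescopes.  The latter is the Riccati equation t E' = E - E^2 + t^2 / 4 of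
E = h + t / 2.  The theorem thus becomes an identity between the beta_{2i}.

On Q[t][H] consider the derivation that extends t d/dt and maps H to
(1 - t) H - H^2, the equation satisfied by h.  The polynomials
P_m = \sum_i f_{mi} H^i are the iterated derivatives of P_0 = H + t / 2 - 1, and
inverting A_m gives P_{m_1} ... P_{m_n} = C + \sum_j F_j P_{j-1} with C in Q[t].
Evaluating at H = h and comparing the coefficients of t^{2k} yields the
identity, provided that C and the F_j are even and that deg F_j is small enough:
- the substitution t -> -t, H -> H + t commutes with the derivation and fixes
  P_0, hence all P_m; the expansion being unique, C and the F_j are even;
- total degree in t and H gives deg F_j <= M + n - j;
- if M > 0, the vanishing of the odd coefficients of C kills the coefficient of
  t^{M+n-1} in F_1, which accounts for the bound T. *)

Require Import Defs.
From HB Require Import structures.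
From mathcomp Require Import all_boot all_order all_algebra.
From mathcomp Require Import all_classical all_reals all_analysis.
From mathcomp Require Import ring lra zify.
Set Implicit Arguments.
Unset Strict Implicit.
Unset Printing Implicit Defensive.
Import Order.TTheory GRing.Theory Num.Theory.
Import numFieldNormedType.Exports.
Local Open Scope ring_scope.

(** * Finite sums *)

Lemma sum_ord_double (V : nmodType) (f : nat -> V) n :
  \sum_(i < 2 * n) f i = \sum_(i < n) (f (2 * i)%N + f (2 * i).+1).
Proof.
elim: n => [|n IHn]; first by rewrite muln0 !big_ord0.
by rewrite mulnS !big_ord_recr /= IHn addrA.
Qed.

Lemma sum_ord_narrow (V : nmodType) (f : nat -> V) b B : (b <= B)%N ->
    (forall i, (b <= i < B)%N -> f i = 0) ->
  \sum_(i < B) f i = \sum_(i < b) f i.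
Proof.
move=> bB f_eq0; rewrite (big_ord_widen B f bB) [RHS]big_mkcond.
by apply: eq_bigr => i _; case: ltnP => // bi; rewrite f_eq0 // bi ltn_ord.
Qed.

Lemma sum_ord_head (V : nmodType) (f : nat -> V) B : (0 < B)%N ->
    (forall i, (0 < i < B)%N -> f i = 0) ->
  \sum_(i < B) f i = f 0%N.
Proof. by move=> B_gt0 f_eq0; rewrite (sum_ord_narrow B_gt0) ?big_ord1. Qed.

Lemma sum_ord_succn n (m : 'I_n -> nat) :
  (\sum_(j < n) (m j).+1 = \sum_(j < n) m j + n)%N.
Proof.
under eq_bigr do rewrite -addn1.
by rewrite big_split sum1_card card_ord.
Qed.

(** * Convolution of the even zeta values *)

Section PowerSums.
Variable F : fieldType.

(* For a = b the last term vanishes, because 0^-1 = 0. *)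
Lemma sum_geometric_mul q (a b : F) : a != 0 -> b != 0 ->
  \sum_(j < q) a ^+ j.+1 * b ^+ (q - j) =
  (a == b)%:R * (q%:R * a ^+ q.+1) + (a ^+ q - b ^+ q) / (b^-1 - a^-1).
Proof.
move=> a_neq0 b_neq0; case: eqVneq => [<-|ab].
  rewrite mul1r !subrr mul0r addr0 mulr_natl.
  rewrite -[q in _ *+ q]card_ord -sumr_const.
  by apply: eq_bigr => j _; rewrite -exprD addSn subnKC // ltnW.
have inv_diff_neq0 : b^-1 - a^-1 != 0.
  by rewrite subr_eq0 (inj_eq invr_inj) eq_sym.
rewrite mul0r add0r; apply: (canRL (mulfK inv_diff_neq0)).
have geometric : a ^+ q - b ^+ q =
    (a - b) * \sum_(j < q) a ^+ j * b ^+ (q - j.+1).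
  rewrite subrXX (reindex_inj rev_ord_inj) /=; congr (_ * _).
  apply: eq_bigr => j _; congr (_ ^+ _ * _); have := ltn_ord j; lia.
rewrite {}geometric mulr_suml mulr_sumr; apply: eq_bigr => j _.
by rewrite -(subnSK (ltn_ord j)) !exprS; field; rewrite a_neq0.
Qed.

Lemma sum_power_sum_mul (I : finType) (a : I -> F) q :
    injective a -> (forall i, a i != 0) ->
  \sum_(j < q) (\sum_i a i ^+ j.+1) * (\sum_i a i ^+ (q - j)) =
  q%:R * (\sum_i a i ^+ q.+1)
  + 2 * \sum_i a i ^+ q * \sum_j ((a j)^-1 - (a i)^-1)^-1.
Proof.
move=> a_inj a_neq0.
transitivity (\sum_i \sum_j ((a i == a j)%:R * (q%:R * a i ^+ q.+1)
                            + (a i ^+ q - a j ^+ q) / ((a j)^-1 - (a i)^-1))).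
  under eq_bigr do rewrite mulr_suml.
  rewrite exchange_big; apply: eq_bigr => i _.
  under eq_bigr do rewrite mulr_sumr.
  rewrite exchange_big; apply: eq_bigr => j _.
  exact: sum_geometric_mul.
under eq_bigr do rewrite big_split /=.
rewrite big_split /=; congr (_ + _).
  rewrite mulr_sumr; apply: eq_bigr => i _.
  rewrite (bigD1 i) //= eqxx mul1r big1 ?addr0 // => j.
  by rewrite (inj_eq a_inj) eq_sym => /negPf ->; rewrite mul0r.
under eq_bigr => i _ do under eq_bigr do rewrite mulrBl.
under eq_bigr do rewrite sumrB.
rewrite sumrB [X in _ - X]exchange_big mulr_natl mulr2n -sumrN.
congr (_ + _); apply: eq_bigr => i _; rewrite mulr_sumr //.
rewrite -sumrN; apply: eq_bigr => j _.
by rewrite -mulrN -[- (_ - _)^-1]invrN opprB.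
Qed.

End PowerSums.

Section HarmonicSums.
Variable R : numFieldType.

Local Notation harmonic_sum := (series (@harmonic R)).

(* The term n = m vanishes, because 0^-1 = 0. *)
Lemma sum_inv_subr m N : (m < N)%N ->
  \sum_(n < N) (n%:R - m%:R)^-1 =
  harmonic_sum (N - m.+1)%N - harmonic_sum m.
Proof.
move=> /subnKC<-; rewrite addKn; elim: (N - m.+1)%N => [|p IHp].
  rewrite addn0 big_ord_recr /= subrr invr0 addr0 !seriesEord /= big_ord0 sub0r.
  rewrite -sumrN (reindex_inj rev_ord_inj); apply: eq_bigr => i _ /=.
  by rewrite -invrN natrB // addrAC subrr sub0r.
rewrite addnS big_ord_recr /= IHp seriesSr addrAC; congr (_ + _^-1 - _).
by rewrite addSn -addnS natrD addrAC subrr add0r.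
Qed.

Lemma sum_inv_addr m N :
  \sum_(n < N) (n + m).+1%:R^-1 = harmonic_sum (N + m)%N - harmonic_sum m :> R.
Proof.
rewrite sub_series_geq ?leq_addl // -[X in index_iota X _]add0n.
by rewrite big_addn addnK big_mkord.
Qed.

Lemma inv_sqr_diffE (m n : nat) :
  (n.+1%:R ^+ 2 - m.+1%:R ^+ 2)^-1 =
  ((n%:R - m%:R)^-1 - (n + m.+1).+1%:R^-1 + (n == m)%:R / (2 * m.+1%:R))
    / (2 * m.+1%:R) :> R.
Proof.
have -> : (n + m.+1).+1%:R = n%:R + m%:R + 2 :> R.
  by rewrite -natr1 natrD -natr1; ring.
have m1_neq0 : m%:R + 1 != 0 :> R by rewrite natr1 pnatr_eq0.
have add_neq0 : n%:R + m%:R + 2 != 0 :> R by rewrite -!natrD pnatr_eq0 addn2.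
rewrite -[m.+1%:R]natr1 -[n.+1%:R]natr1; case: eqVneq => [nm|nm] /=.
  by rewrite nm !subrr invr0 in add_neq0 *; field; rewrite m1_neq0 add_neq0.
have sub_neq0 : n%:R - m%:R != 0 :> R by rewrite subr_eq0 eqr_nat.
have -> : (n%:R + 1) ^+ 2 - (m%:R + 1) ^+ 2 =
    (n%:R - m%:R) * (n%:R + m%:R + 2) :> R by ring.
by field; rewrite m1_neq0 add_neq0.
Qed.

Lemma sum_inv_sqr_diff m N : (m < N)%N ->
  \sum_(n < N) (n.+1%:R ^+ 2 - m.+1%:R ^+ 2)^-1 =
  3 / 4 * (m.+1%:R ^+ 2)^-1
  - (harmonic_sum (N + m.+1)%N - harmonic_sum (N - m.+1)%N)
    / (2 * m.+1%:R) :> R.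
Proof.
move=> mN; under eq_bigr do rewrite inv_sqr_diffE.
have diagonal : \sum_(n < N) (n == m :> nat)%:R = 1 :> R.
  rewrite (bigD1 (Ordinal mN)) //= eqxx big1 ?addr0 // => n.
  by rewrite -val_eqE /= => /negPf ->.
rewrite -mulr_suml big_split sumrB /= sum_inv_addr -mulr_suml diagonal.
rewrite sum_inv_subr // [harmonic_sum m.+1]seriesSr /=.
by field; rewrite nat1r pnatr_eq0.
Qed.

Lemma harmonic_diff_bounds p q :
  0 <= harmonic_sum (p + q)%N - harmonic_sum p <= q%:R / p.+1%:R.
Proof.
rewrite addnC -sum_inv_addr; apply/andP; split.
  by apply: sumr_ge0 => n _; rewrite invr_ge0.
rewrite mulr_natl -[q in leRHS]card_ord -sumr_const; apply: ler_sum => n _.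
by rewrite lef_pV2 ?posrE // ler_nat ltnS leq_addl.
Qed.

Lemma harmonic_diff_div_bounds m N : (m < N)%N ->
  0 <= (harmonic_sum (N + m.+1)%N - harmonic_sum (N - m.+1)%N)
         / (2 * m.+1%:R) <= (N - m)%:R^-1.
Proof.
move=> mN; have := harmonic_diff_bounds (N - m.+1) (2 * m.+1).
have -> : (N - m.+1 + 2 * m.+1 = N + m.+1)%N by lia.
rewrite subnSK // => /andP[diff_ge0 diff_le]; rewrite divr_ge0 ?mulr_ge0 //=.
by rewrite ler_pdivrMr ?mulr_gt0 // [leRHS]mulrC -natrM.
Qed.

End HarmonicSums.

Lemma inv_sqr_div_le (R : realFieldType) (x y : R) : 1 <= x -> 1 <= y ->
  (x ^+ 2)^-1 / y <= ((x ^+ 2)^-1 + (x + y - 1)^-1) / (x + y).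
Proof.
move=> x_ge1 y_ge1.
have -> : (x ^+ 2)^-1 / y = ((x ^+ 2)^-1 + (x * y)^-1) / (x + y).
  by field; rewrite !gt_eqF //; lra.
rewrite ler_pM2r ?invr_gt0; last by lra.
by rewrite lerD2l lef_pV2 ?posrE; nra.
Qed.

Section ZetaConvolution.
Variable R : realType.

Local Notation harmonic_sum := (series (@harmonic R)).

Definition zeta_partial (s N : nat) : R := \sum_(i < N) (i.+1%:R ^+ s)^-1.

Lemma zeta_partial_nondecreasing s : nondecreasing_seq (zeta_partial s).
Proof.
apply/nondecreasing_seqP => N.
by rewrite /zeta_partial big_ord_recr lerDl invr_ge0 exprn_ge0.
Qed.

Lemma zeta_partial_le2 s N : (2 <= s)%N -> zeta_partial s N <= 2.
Proof.
move=> s_ge2; apply: le_trans (zeta_partial_nondecreasing s (leqnSn N)) _.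
suff : zeta_partial s N.+1 <= 2 - N.+1%:R^-1.
  by move/le_trans; apply; rewrite gerBl invr_ge0.
elim: N => [|N IHN]; first by rewrite /zeta_partial big_ord1 expr1n invr1; lra.
rewrite /zeta_partial big_ord_recr /= -/(zeta_partial s N.+1).
suff : (N.+2%:R ^+ s)^-1 <= N.+1%:R^-1 - N.+2%:R^-1 :> R.
  by move=> /(lerD IHN); rewrite subrKA.
have -> : N.+1%:R^-1 - N.+2%:R^-1 = (N.+1%:R * N.+2%:R)^-1 :> R.
  rewrite -[N.+2%:R]natr1; move: N.+1%:R (ltr0Sn R N) => x x_gt0.
  by field; rewrite !gt_eqF ?addr_gt0.
rewrite lef_pV2 ?posrE ?exprn_gt0 ?mulr_gt0 //.
apply: le_trans (_ : N.+2%:R ^+ 2 <= _); last by rewrite ler_weXn2l ?ler1n.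
by rewrite expr2 ler_pM2r // ler_nat.
Qed.

Lemma cvg_zeta_partial s : (2 <= s)%N ->
  (zeta_partial s @ \oo --> zeta R s)%classic.
Proof.
move=> s_ge2; rewrite /zeta gtn_eqF ?(ltnW s_ge2) // seriesEord.
apply: nondecreasing_is_cvgn; first exact: zeta_partial_nondecreasing.
by exists 2 => _ [N _ <-]; exact: zeta_partial_le2.
Qed.

Lemma zeta_ge1 s : (2 <= s)%N -> 1 <= zeta R s.
Proof.
move=> s_ge2; rewrite -(cvg_lim _ (cvg_zeta_partial s_ge2)) //.
apply: le_trans (nondecreasing_cvgn_le _ _ 1); last first.
- exact: cvgP (cvg_zeta_partial s_ge2).
- exact: zeta_partial_nondecreasing.
- by rewrite /zeta_partial big_ord1 expr1n invr1.
Qed.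

Definition zeta_conv_error (q N : nat) : R :=
  \sum_(m < N) (m.+1%:R ^+ (2 * q))^-1
    * ((harmonic_sum (N + m.+1)%N - harmonic_sum (N - m.+1)%N)
         / (2 * m.+1%:R)).

Lemma zeta_partial_conv q N :
  \sum_(j < q) zeta_partial (2 * j.+1) N * zeta_partial (2 * (q - j)) N =
  (q%:R + 3 / 2) * zeta_partial (2 * q.+1) N - 2 * zeta_conv_error q N.
Proof.
pose a (i : 'I_N) : R := (i.+1%:R ^+ 2)^-1.
have a_inj : injective a.
  move=> i j /invr_inj/eqP; rewrite -!natrX eqr_nat eqn_exp2r // eqSS.
  by move/eqP/val_inj.
have zetaE k : zeta_partial (2 * k) N = \sum_i a i ^+ k.
  by apply: eq_bigr => i _; rewrite exprM exprVn.
under eq_bigr do rewrite !zetaE.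
rewrite sum_power_sum_mul // => [|i]; last first.
  by rewrite invr_eq0 expf_neq0 ?pnatr_eq0.
have -> : \sum_i a i ^+ q * \sum_j ((a j)^-1 - (a i)^-1)^-1 =
    3 / 4 * zeta_partial (2 * q.+1) N - zeta_conv_error q N.
  rewrite zetaE /zeta_conv_error mulr_sumr -sumrB; apply: eq_bigr => i _.
  under eq_bigr do rewrite /a !invrK.
  rewrite sum_inv_sqr_diff // mulrBr mulrCA -/(a i) -exprSr.
  by rewrite [in RHS]exprM -exprVn.
by rewrite zetaE; field.
Qed.

Lemma zeta_conv_error_bounds q N : (0 < q)%N ->
  0 <= zeta_conv_error q N <= 3 / N.+1%:R.
Proof.
move=> q_gt0; apply/andP; split.
  apply: sumr_ge0 => m _; rewrite mulr_ge0 ?invr_ge0 ?exprn_ge0 //.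
  by have /andP[] := harmonic_diff_div_bounds R (ltn_ord m).
have [->|N_gt0] := posnP N; first by rewrite /zeta_conv_error big_ord0 divr_ge0.
apply: le_trans (_ : \sum_(m < N) ((m.+1%:R ^+ 2)^-1 + N%:R^-1) / N.+1%:R <= _).
  apply: ler_sum => m _.
  have /andP[err_ge0 err_le] := harmonic_diff_div_bounds R (ltn_ord m).
  apply: le_trans (ler_pM _ err_ge0 (_ : _ <= (m.+1%:R ^+ 2)^-1) err_le) _.
  - by rewrite invr_ge0 exprn_ge0.
  - by rewrite lef_pV2 ?posrE ?exprn_gt0 // ler_weXn2l ?ler1n // leq_pmulr.
  have N1E : N.+1%:R = m.+1%:R + (N - m)%:R :> R.
    by rewrite -natrD addSn subnKC // ltnW.
  have -> : N%:R = m.+1%:R + (N - m)%:R - 1 :> R by rewrite -N1E -natr1 addrK.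
  by rewrite N1E inv_sqr_div_le // ler1n // subn_gt0.
rewrite -mulr_suml ler_pM2r ?invr_gt0 // big_split /= -/(zeta_partial 2 N).
rewrite sumr_const card_ord -[_^-1 *+ N]mulr_natl divff ?pnatr_eq0 -?lt0n //.
by have := zeta_partial_le2 N (leqnn 2); lra.
Qed.

Lemma cvg_zeta_conv_error q : (0 < q)%N ->
  (zeta_conv_error q @ \oo --> (0 : R))%classic.
Proof.
move=> q_gt0.
apply: (@squeeze_cvgr _ _ _ _ (fun=> 0) (fun N => 3 * harmonic N)).
- by apply: nearW => N; exact: zeta_conv_error_bounds.
- exact: cvg_cst.
- rewrite -[X in (_ --> X)%classic](mulr0 3).
  by apply: cvgMr; exact: cvg_harmonic.
Qed.

Lemma zeta_conv q : (0 < q)%N ->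
  \sum_(j < q) zeta R (2 * j.+1) * zeta R (2 * (q - j)) =
  (q%:R + 3 / 2) * zeta R (2 * q.+1).
Proof.
move=> q_gt0.
pose rhs N :=
  (q%:R + 3 / 2) * zeta_partial (2 * q.+1) N - 2 * zeta_conv_error q N.
have cvg_lhs : (rhs @ \oo -->
    \sum_(j < q) zeta R (2 * j.+1) * zeta R (2 * (q - j)))%classic.
  under [rhs]eq_fun do rewrite -zeta_partial_conv.
  apply: cvg_big => [|j _]; first exact: add_continuous.
  by apply: cvgM; apply: cvg_zeta_partial; have := ltn_ord j; lia.
have cvg_rhs : (rhs @ \oo --> (q%:R + 3 / 2) * zeta R (2 * q.+1))%classic.
  rewrite -[X in (_ --> X)%classic]subr0 -[X in _ - X](mulr0 2).
  apply: cvgB; apply: cvgMr; last exact: cvg_zeta_conv_error.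
  by apply: cvg_zeta_partial; lia.
exact: cvg_unique cvg_lhs cvg_rhs.
Qed.

End ZetaConvolution.

(** * Truncated power series *)

Section TruncatedPolynomials.
Variable R : nzRingType.
Implicit Types (p q : {poly R}) (N : nat).

Lemma take_polyM N p q :
  take_poly N (take_poly N p * take_poly N q) = take_poly N (p * q).
Proof.
apply/polyP => i; rewrite !coef_take_poly; case: ltnP => // iN.
rewrite !coefM; apply: eq_bigr => j _.
by rewrite !coef_take_poly !ifT //; have := ltn_ord j; lia.
Qed.

Lemma eq_take_polyM N p p' q q' :
    take_poly N p = take_poly N p' -> take_poly N q = take_poly N q' ->
  take_poly N (p * q) = take_poly N (p' * q').
Proof. by rewrite -take_polyM => -> ->; rewrite take_polyM. Qed.

Lemma eq_take_poly_prod N I (r : seq I) (p q : I -> {poly R}) :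
    (forall i, take_poly N (p i) = take_poly N (q i)) ->
  take_poly N (\prod_(i <- r) p i) = take_poly N (\prod_(i <- r) q i).
Proof.
by move=> eq_pq; elim/big_rec2: _ => // i p' q' _; exact: eq_take_polyM.
Qed.

End TruncatedPolynomials.

Lemma coef_prod (R : comNzRingType) (I : finType) (p : I -> {poly R}) k :
  (\prod_i p i)`_k =
  \sum_(c : {ffun I -> 'I_k.+1} | (\sum_i c i == k)%N) \prod_i (p i)`_(c i).
Proof.
have trunc i :
    take_poly k.+1 (p i) = take_poly k.+1 (\poly_(j < k.+1) (p i)`_j).
  by rewrite [RHS]take_poly_id ?size_poly.
have /polyP/(_ k) := eq_take_poly_prod (index_enum I) trunc.
rewrite !coef_take_poly ltnSn => ->; under eq_bigr do rewrite poly_def.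
rewrite bigA_distr_bigA coef_sum [RHS]big_mkcond; apply: eq_bigr => c _ /=.
rewrite scaler_prod prodrXr coefZ coefXn eq_sym.
by case: eqP; rewrite ?mulr1 ?mulr0.
Qed.

Section EulerOperator.
Variable R : comNzRingType.
Implicit Types p q : {poly R}.

(* t d/dt *)
Definition theta p : {poly R} := 'X * p^`().

Lemma theta_is_linear : linear theta.
Proof. by move=> c p q; rewrite /theta derivD derivZ mulrDr scalerAr. Qed.

HB.instance Definition _ :=
  GRing.isLinear.Build R {poly R} {poly R} _ theta theta_is_linear.

Lemma thetaM p q : theta (p * q) = theta p * q + p * theta q.
Proof. by rewrite /theta derivM; ring. Qed.

Lemma thetaC (c : R) : theta c%:P = 0.
Proof. by rewrite /theta derivC mulr0. Qed.

Lemma thetaX : theta 'X = 'X.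
Proof. by rewrite /theta derivX mulr1. Qed.

Lemma coef_theta p i : (theta p)`_i = i%:R * p`_i.
Proof.
rewrite coefXM; case: i => [|i] /=; first by rewrite mul0r.
by rewrite coef_deriv mulr_natl.
Qed.

Lemma coef_iter_theta k p i : (iter k theta p)`_i = i%:R ^+ k * p`_i.
Proof.
elim: k => [|k IHk] /=; first by rewrite mul1r.
by rewrite coef_theta IHk mulrA -exprS.
Qed.

Lemma take_poly_theta N p : take_poly N (theta p) = theta (take_poly N p).
Proof.
apply/polyP => i; rewrite coef_theta !coef_take_poly coef_theta.
by case: ifP; rewrite ?mulr0.
Qed.

Lemma theta_comp_oppX p : theta (p \Po - 'X) = theta p \Po - 'X.
Proof.
by rewrite /theta deriv_comp derivN derivX comp_polyM comp_polyX; ring.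
Qed.

End EulerOperator.
Arguments theta {R} p.

Lemma coef_comp_oppX (R : comNzRingType) (p : {poly R}) i :
  (p \Po - 'X)`_i = (-1) ^+ i * p`_i.
Proof.
elim/poly_ind: p i => [|p c IHp] i; first by rewrite comp_poly0 coef0 mulr0.
rewrite comp_poly_MXaddC mulrN coefD coefN coefMX coefC coefD coefMX coefC.
case: i => [|i] /=; first by rewrite oppr0 mul1r.
by rewrite IHp !addr0 exprS mulN1r mulNr.
Qed.

Lemma coef_odd_eq0 (R : numDomainType) (p : {poly R}) i :
  p \Po - 'X = p -> odd i -> p`_i = 0.
Proof.
move=> p_even odd_i; have := congr1 (coefp i) p_even.
rewrite /= coef_comp_oppX -signr_odd odd_i expr1 mulN1r => /eqP.
by rewrite eqNr => /eqP.
Qed.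

Lemma coefM_comp_X2 (R : comNzRingType) (p q : {poly R}) k :
  (p * (q \Po 'X^2))`_(2 * k) = \sum_(l < k.+1) p`_(2 * l) * q`_(k - l).
Proof.
rewrite -{1}[p]poly_even_odd mulrDl mulrAC -!comp_polyM coefD coefMX.
rewrite coef_comp_poly_Xn // dvdn_mulr // mulKn //.
rewrite [X in _ + X](_ : _ = 0) ?addr0; last first.
  case: k => [|k] //; rewrite muln_eq0 /= coef_comp_poly_Xn // ifN //; lia.
by rewrite coefM; apply: eq_bigr => l _; rewrite coef_even_poly mul2n.
Qed.

(** * Bernoulli numbers *)

Lemma natr_fact_neq0 (R : numDomainType) i : i`!%:R != 0 :> R.
Proof. by rewrite pnatr_eq0 -lt0n fact_gt0. Qed.

Definition bern (i : nat) : rat := bernoulli_num i / i`!%:R.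

Lemma bern0 : bern 0 = 1.
Proof.
by rewrite /bern /bernoulli_num /fps_inv /= big_ord0 !fact0 !invr1 subr0 !mulr1.
Qed.

Definition bern_poly (N : nat) : {poly rat} := \poly_(i < N) bern i.

(* The truncation of (e^t - 1) / t. *)
Definition expm1_poly (N : nat) : {poly rat} := \poly_(i < N) (i.+1`!%:R)^-1.

Lemma bern_polyM_expm1 N :
  take_poly N (bern_poly N * expm1_poly N) = take_poly N 1.
Proof.
apply/polyP => i; rewrite !coef_take_poly; case: ltnP => // iN.
rewrite coef1 -(@fps_invP (fun n => (n.+1`!%:R)^-1)) ?invr1 // coefM.
apply: eq_bigr => j _; have := ltn_ord j; rewrite ltnS => ji.
rewrite !coef_poly (leq_ltn_trans ji iN) (leq_ltn_trans (leq_subr j i) iN).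
by rewrite /bern /bernoulli_num [X in X * _]mulrC mulKf ?natr_fact_neq0.
Qed.

Lemma theta_expm1_poly N :
  take_poly N (theta (expm1_poly N)) =
  take_poly N ('X * expm1_poly N + 1 - expm1_poly N).
Proof.
apply/polyP => i; rewrite !coef_take_poly; case: ltnP => // iN.
rewrite coef_theta coefB coefD coefXM coef1 !coef_poly iN.
case: i iN => [|i] iN /=; first by rewrite mul0r invr1; ring.
rewrite (ltnW iN) (factS i.+1) natrM invfM -[i.+2%:R]natr1 addr0.
by field; rewrite natr_fact_neq0 nat1r natr1 pnatr_eq0.
Qed.

(* The Riccati equation t h' = (1 - t) h - h^2 of h = t / (e^t - 1). *)
Lemma theta_bern_poly N :
  take_poly N (theta (bern_poly N)) =
  take_poly N ((1 - 'X) * bern_poly N - bern_poly N ^+ 2).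
Proof.
set h := bern_poly N; pose u := expm1_poly N.
have hu1 : take_poly N (h * u) = take_poly N 1 by exact: bern_polyM_expm1.
have hu_mul p : take_poly N (p * (h * u)) = take_poly N p.
  by rewrite -[p in RHS]mulr1; exact: eq_take_polyM.
have h_theta_hu : take_poly N (h * theta (h * u)) = 0.
  rewrite -take_polyM take_poly_theta hu1 -take_poly_theta thetaC.
  by rewrite take_poly0r mulr0 take_poly0r.
transitivity (take_poly N (theta h * (h * u))); first by rewrite hu_mul.
have -> : theta h * (h * u) = h * theta (h * u) - h * h * theta u.
  by rewrite thetaM; ring.
rewrite linearB /= h_theta_hu sub0r.
rewrite (eq_take_polyM (erefl _) (theta_expm1_poly N)) -/u.
have -> : h * h * ('X * u + 1 - u) = ('X - 1) * h * (h * u) + h ^+ 2 by ring.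
rewrite take_polyD hu_mul -take_polyD -linearN /=.
by congr (take_poly N _); ring.
Qed.

Definition even_bern (i : nat) : rat := bern i + (i == 1%N)%:R / 2.

Lemma even_bernE i : i != 1%N -> even_bern i = bern i.
Proof. by move=> /negPf i_neq1; rewrite /even_bern i_neq1 mul0r addr0. Qed.

(* The truncation of t / (e^t - 1) + t / 2. *)
Definition even_bern_poly (N : nat) : {poly rat} := bern_poly N + 2^-1 *: 'X.

Lemma coef_even_bern_poly N i :
  (i < N)%N -> (even_bern_poly N)`_i = even_bern i.
Proof.
by move=> iN; rewrite coefD coefZ coefX coef_poly iN [2^-1 * _]mulrC.
Qed.

Lemma theta_even_bern_poly N :
  take_poly N (theta (even_bern_poly N)) =
  take_poly N (even_bern_poly N - even_bern_poly N ^+ 2 + 4^-1 *: 'X^2).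
Proof.
rewrite /even_bern_poly linearD linearZ /= thetaX [in LHS]take_polyD.
rewrite theta_bern_poly -take_polyD; congr (take_poly N _).
have -> : (4^-1 : rat) = 2^-1 * 2^-1 by [].
rewrite -!mul_polyC polyCM.
have double_half : 2 * (2^-1 : rat)%:P = 1 :> {poly rat}.
  by rewrite -(polyC_natr rat 2) -polyCM mulfV.
move: (bern_poly N) (2^-1)%:P double_half => h c double_c.
have -> : (1 - 'X) * h = h - 2 * c * ('X * h) by rewrite double_c; ring.
by ring.
Qed.

Lemma even_bern_rec i :
  i.+2%:R * even_bern i.+1 =
  (i == 1%N)%:R / 4 - \sum_(j < i) even_bern j.+1 * even_bern (i - j).
Proof.
have even_bern0 : even_bern 0 = 1 by rewrite even_bernE ?bern0.
have := theta_even_bern_poly i.+2; have := @coef_even_bern_poly i.+2.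
move: (even_bern_poly _) => E coefE /polyP/(_ i.+1).
rewrite !coef_take_poly ltnSn coef_theta !coefD coefN coefZ coefXn eqSS.
rewrite expr2 coefM big_ord_recr big_ord_recl /= subnn subn0.
rewrite !coefE // even_bern0.
under eq_bigr => j _.
  have ji := ltn_ord j; rewrite !coefE ?subSS; [|lia|rewrite /bump; lia].
  over.
by rewrite -[i.+2%:R]natr1 => rec; rewrite /bump; lra.
Qed.

Lemma even_bern_odd i : odd i -> even_bern i = 0.
Proof.
elim/ltn_ind: i => -[|i] // IH odd_i; have := even_bern_rec i.
rewrite big1 => [|j _]; last first.
  have ji := ltn_ord j; have [odd_j|even_j] := boolP (odd j.+1).
    by rewrite IH ?mul0r //; lia.
  by rewrite [X in _ * X]IH ?mulr0 //; lia.
case: eqP odd_i => [->//|_ _]; rewrite mul0r subr0 => /eqP.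
by rewrite mulf_eq0 pnatr_eq0 => /eqP.
Qed.

Lemma bern2 : bern 2 = 12^-1.
Proof.
have := even_bern_rec 1; rewrite big_ord1 (@even_bern_odd 1) // mul0r.
by rewrite even_bernE //=; lra.
Qed.

Lemma bern_conv q : (0 < q)%N ->
  \sum_(j < q) bern (2 * j.+1) * bern (2 * (q - j)) =
  - (2 * q.+1).+1%:R * bern (2 * q.+1).
Proof.
move=> q_gt0; have := even_bern_rec (2 * q).+1.
rewrite [_ == 1%N]gtn_eqF ?mul0r ?sub0r; last by lia.
rewrite -[(2 * q).+2]add2n -mulnS => rec.
rewrite -(@even_bernE (2 * q.+1)) ?mulNr ?{}rec ?opprK; last by lia.
rewrite big_ord_recr /= even_bern_odd ?mul0r ?addr0; last by lia.
rewrite (sum_ord_double (fun j => even_bern j.+1 * even_bern ((2 * q).+1 - j))).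
apply: eq_bigr => j _; have jq := ltn_ord j.
rewrite even_bern_odd ?mul0r ?add0r; last by lia.
by rewrite !even_bernE; [congr (bern _ * bern _); lia|lia|lia].
Qed.

(** * Derivations and expansions in R[t][H] *)

Section ThetaExtension.
Variables (R : comNzRingType) (D : {poly {poly R}}).
Implicit Types (P Q : {poly {poly R}}) (c h : {poly R}).

(* The derivation of R[t][H], with H the outer variable, that extends t d/dt
   and maps H to D. *)
Definition theta_ext P := map_poly theta P + P^`() * D.

Lemma theta_ext_is_zmod_morphism : zmod_morphism theta_ext.
Proof.
by move=> P Q; rewrite /theta_ext raddfB derivB mulrBl opprD addrACA.
Qed.

HB.instance Definition _ := GRing.isZmodMorphism.Build
  {poly {poly R}} {poly {poly R}} theta_ext theta_ext_is_zmod_morphism.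

Lemma theta_extM P Q : theta_ext (P * Q) = theta_ext P * Q + P * theta_ext Q.
Proof.
have map_thetaM : map_poly theta (P * Q) =
    map_poly theta P * Q + P * map_poly theta Q.
  apply/polyP => i; rewrite coefD coef_map /= !coefM raddf_sum -big_split.
  by apply: eq_bigr => j _; rewrite /= thetaM !coef_map.
by rewrite /theta_ext map_thetaM derivM; ring.
Qed.

Lemma theta_extC c : theta_ext c%:P = (theta c)%:P.
Proof. by rewrite /theta_ext map_polyC derivC mul0r addr0. Qed.

Lemma theta_extX : theta_ext 'X = D.
Proof.
rewrite /theta_ext derivX mul1r -[RHS]add0r; congr (_ + _).
by apply/polyP => i; rewrite coef_map coefX coef0 -polyC_natr /= thetaC.
Qed.

Lemma theta_horner N h P :
    take_poly N (theta h) = take_poly N D.[h] ->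
  take_poly N (theta P.[h]) = take_poly N (theta_ext P).[h].
Proof.
move=> theta_h; elim/poly_ind: P => [|P c IHP].
  by rewrite -polyC0 theta_extC !hornerC.
rewrite raddfD /= theta_extM theta_extC theta_extX.
move: (theta_ext P) IHP => thetaP IHP.
rewrite !(hornerD, hornerM, hornerX, hornerC) raddfD /= thetaM !take_polyD.
by congr (_ + _ + _); apply: eq_take_polyM.
Qed.

Lemma theta_ext_commute (s : {rmorphism {poly {poly R}} -> {poly {poly R}}}) P :
    (forall c, s (theta_ext c%:P) = theta_ext (s c%:P)) ->
    s (theta_ext 'X) = theta_ext (s 'X) ->
  s (theta_ext P) = theta_ext (s P).
Proof.
move=> sC sX; elim/poly_ind: P => [|P c IHP]; first by rewrite !raddf0.
rewrite [theta_ext (P * _ + _)]raddfD [s (theta_ext _ + _)]rmorphD /= sC.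
rewrite [s (P * _ + _)]rmorphD [theta_ext (s _ + _)]raddfD /=; congr (_ + _).
by rewrite rmorphM !theta_extM [LHS]rmorphD !rmorphM /= IHP sX.
Qed.

End ThetaExtension.

Section TotalDegree.
Variable R : nzRingType.
Implicit Types P Q : {poly {poly R}}.

Definition tdeg_le (d : nat) P := forall i j, (d < i + j)%N -> P`_i`_j = 0.

Lemma tdeg_leB d P Q : tdeg_le d P -> tdeg_le d Q -> tdeg_le d (P - Q).
Proof. by move=> P_deg Q_deg i j ij; rewrite !coefB P_deg ?Q_deg ?subr0. Qed.

Lemma tdeg_leM d e P Q : tdeg_le d P -> tdeg_le e Q -> tdeg_le (d + e) (P * Q).
Proof.
move=> P_deg Q_deg i j ij; rewrite coefM coef_sum big1 // => a _.
have ai := ltn_ord a; rewrite coefM big1 // => b _; have bj := ltn_ord b.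
have [dab|abd] := ltnP d (a + b); first by rewrite P_deg ?mul0r.
by rewrite Q_deg ?mulr0 //; lia.
Qed.

Lemma tdeg_leC d (c : {poly R}) :
  (forall j, (d < j)%N -> c`_j = 0) -> tdeg_le d c%:P.
Proof. by move=> c_deg [|i] j ij; rewrite coefC ?coef0 ?c_deg. Qed.

Lemma tdeg_le_prod I (r : seq I) (d : I -> nat) (P : I -> {poly {poly R}}) :
  (forall i, tdeg_le (d i) (P i)) ->
  tdeg_le (\sum_(i <- r) d i) (\prod_(i <- r) P i).
Proof.
move=> P_deg; elim/big_rec2: _ => [|i e Q _]; last exact: tdeg_leM.
by case=> [|i] [|j] //; rewrite !coefE.
Qed.

End TotalDegree.

(* Together with 1, the polynomials P j form a basis of R[t][H] over R[t]. *)
Section TriangularFamily.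
Variables (R : idomainType) (P : nat -> {poly {poly R}}) (lc : nat -> R).
Hypothesis lc_neq0 : forall j, lc j != 0.
Hypothesis P_lead : forall j, (P j)`_j.+1 = (lc j)%:P.
Hypothesis P_tdeg : forall j, tdeg_le j.+1 (P j).
Implicit Types (K d : nat) (c : {poly R}) (a : nat -> {poly R}).

Definition tri_comb K c a := c%:P + \sum_(j < K) (a j)%:P * P j.

Lemma tri_combS K c a : tri_comb K.+1 c a = tri_comb K c a + (a K)%:P * P K.
Proof. by rewrite /tri_comb big_ord_recr addrA. Qed.

Lemma coef_tri_comb_lead K c a : (tri_comb K.+1 c a)`_K.+1 = lc K *: a K.
Proof.
rewrite tri_combS coefD coefCM P_lead mulrC mul_polyC.
rewrite coefD coefC coef_sum big1 ?addr0 ?add0r // => j _.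
rewrite coefCM (_ : (P j)`_K.+1 = 0) ?mulr0 //; apply/polyP => i.
by rewrite coef0 P_tdeg //; have := ltn_ord j; lia.
Qed.

Lemma tri_comb_eq0 K c a : tri_comb K c a = 0 ->
  c = 0 /\ forall j, (j < K)%N -> a j = 0.
Proof.
elim: K => [|K IHK] comb0.
  split=> //; apply: polyC_inj.
  by rewrite polyC0 -comb0 /tri_comb big_ord0 addr0.
have aK : a K = 0.
  have /esym/eqP := coef_tri_comb_lead K c a; rewrite comb0 coef0.
  by rewrite scale_poly_eq0 (negPf (lc_neq0 K)) => /eqP.
have [|c_eq0 a_eq0] := IHK; first by rewrite -comb0 tri_combS aK mul0r addr0.
by split=> // j; rewrite ltnS leq_eqVlt => /predU1P[->//|/a_eq0].
Qed.

Lemma tri_comb_tdeg d K c a : tdeg_le d (tri_comb K c a) ->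
  forall j i, (j < K)%N -> (d < i + j.+1)%N -> (a j)`_i = 0.
Proof.
elim: K => [//|K IHK] comb_tdeg.
have aK i : (d < i + K.+1)%N -> (a K)`_i = 0.
  rewrite addnC => /comb_tdeg/eqP; rewrite coef_tri_comb_lead coefZ.
  by rewrite mulf_eq0 (negPf (lc_neq0 K)) => /eqP.
have aKP_tdeg : tdeg_le d ((a K)%:P * P K).
  have [Kd|dK] := leqP K.+1 d.
    rewrite -(subnK Kd); apply: tdeg_leM _ (@P_tdeg K); apply: tdeg_leC => i Ki.
    by rewrite aK //; lia.
  suff -> : a K = 0 by rewrite mul0r => i j _; rewrite !coef0.
  by apply/polyP => i; rewrite coef0 aK //; lia.
move=> j i; rewrite ltnS leq_eqVlt => /predU1P[->|jK]; first exact: aK.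
apply: IHK jK; rewrite -[tri_comb K c a](addrK ((a K)%:P * P K)) -tri_combS.
exact: tdeg_leB.
Qed.

Lemma tri_comb_fixed (s : {rmorphism {poly {poly R}} -> {poly {poly R}}})
    (s0 : {additive {poly R} -> {poly R}}) :
    (forall c, s c%:P = (s0 c)%:P) -> (forall j, s (P j) = P j) ->
  forall K c a, s (tri_comb K c a) = tri_comb K c a ->
  s0 c = c /\ forall j, (j < K)%N -> s0 (a j) = a j.
Proof.
move=> sC sP K c a /eqP; rewrite -subr_eq0 => /eqP comb_fixed.
have comb0 : tri_comb K (s0 c - c) (fun j => s0 (a j) - a j) = 0.
  rewrite -comb_fixed /tri_comb [s (_ + _)]rmorphD sC rmorph_sum opprD addrACA.
  rewrite -polyCB; congr (_ + _); rewrite -sumrB; apply: eq_bigr => j _.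
  by rewrite rmorphM /= sC sP polyCB mulrBl.
have [c_eq a_eq] := tri_comb_eq0 comb0.
by split=> [|j /a_eq /subr0_eq //]; exact: subr0_eq.
Qed.

End TriangularFamily.

Lemma invmx_trig (R : comUnitRingType) n (A : 'M[R]_n) :
  A \in unitmx -> is_trig_mx A -> is_trig_mx (invmx A).
Proof.
move=> A_unit A_trig; have /is_trig_mxP A_upper0 := A_trig.
have diag_unit i : A i i \is a GRing.unit.
  move: A_unit; rewrite unitmxE (det_trig A_trig) (bigD1 i) //=.
  by rewrite unitrM => /andP[].
apply/is_trig_mxP => i j; have [d] := ubnP i; elim: d => // d IHd in i *.
rewrite ltnS => id ij; have /matrixP/(_ i j) := mulmxV A_unit.
rewrite !mxE -val_eqE (ltn_eqF ij) (bigD1 i) //= big1 ?addr0 => [|c ci].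
  by move/(canRL (mulKr (diag_unit i))); rewrite mulr0.
have [ic|ci_le] := ltnP i c; first by rewrite A_upper0 ?mul0r.
have lt_ci : (c < i)%N by rewrite ltn_neqAle ci_le andbT.
by rewrite IHd ?mulr0 //; [exact: leq_trans id|exact: ltn_trans ij].
Qed.

(** * The polynomials f_{mi} and F_j *)

(* The right-hand side of the equation t h' = (1 - t) h - h^2, with H for h. *)
Definition riccati : {poly {poly rat}} := 'X * (1 - 'X)%:P - 'X^2.

(* The substitution t |-> -t, H |-> H + t, which reflects that
   h(-t) = h(t) + t for h(t) = t / (e^t - 1). *)
Definition reflection : {poly {poly rat}} -> {poly {poly rat}} :=
  comp_poly ('X + 'X%:P) \o map_poly (comp_poly (- 'X)).

HB.instance Definition _ := GRing.RMorphism.copy reflection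
  (comp_poly ('X + 'X%:P) \o map_poly (comp_poly (- 'X))).

Lemma reflectionC c : reflection c%:P = (c \Po - 'X)%:P.
Proof. by rewrite /reflection /= map_polyC comp_polyC. Qed.

Lemma reflectionX : reflection 'X = 'X + 'X%:P.
Proof. by rewrite /reflection /= map_polyX comp_polyX. Qed.

Lemma reflection_theta_ext P :
  reflection (theta_ext riccati P) = theta_ext riccati (reflection P).
Proof.
apply: theta_ext_commute => [c|].
  by rewrite /= reflectionC !theta_extC reflectionC theta_comp_oppX.
rewrite /= reflectionX [RHS]raddfD /= !theta_extX theta_extC thetaX /riccati.
rewrite rmorphB rmorphXn rmorphM /= reflectionX reflectionC.
rewrite comp_polyB comp_polyX -polyC1 comp_polyC opprK polyCD polyCB polyC1.
by move: 'X%:P => t; ring.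
Qed.

Lemma f_gt_eq0 m i : (m.+1 < i)%N -> f_ m i = 0.
Proof. by case: m => [|m]; case: i => [|[|i]] //= im; rewrite !ifN //; lia. Qed.

Lemma f_rec m i : f_ m.+1 i =
  theta (f_ m i) + i%:R *: ((1 - 'X) * f_ m i) - i.-1%:R *: f_ m i.-1.
Proof.
case: i => [|i]; first by rewrite /= !scale0r addr0 subr0.
rewrite /=; case: (leqP i.+1 m.+1) => // mi.
rewrite (@f_gt_eq0 m i.+1) // raddf0 mulr0 scaler0 !add0r eqSS.
by case: eqP => [->//|i_neq]; rewrite f_gt_eq0 ?scaler0 ?oppr0 //; lia.
Qed.

Lemma f_col0 m : f_ m 0 = 2^-1 *: 'X - (m == 0%N)%:R.
Proof.
elim: m => [//|m IHm]; rewrite f_rec IHm !scale0r addr0 !subr0.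
by rewrite linearB linearZ /= thetaX -polyC_natr thetaC subr0.
Qed.

Lemma f_diag_neq0 m : (-1) ^+ m * m`!%:R != 0 :> rat.
Proof. by rewrite mulf_neq0 ?signr_eq0 ?natr_fact_neq0. Qed.

Definition fgen (m : nat) : {poly {poly rat}} := \poly_(i < m.+2) f_ m i.

Lemma coef_fgen m i : (fgen m)`_i = f_ m i.
Proof. by rewrite coef_poly; case: ltnP => // /f_gt_eq0. Qed.

Lemma fgen0 : fgen 0 = 'X + (2^-1 *: 'X - 1)%:P.
Proof.
apply/polyP => i; rewrite coef_fgen coefD coefX coefC.
by case: i => [|[|i]]; rewrite /= ?add0r ?addr0.
Qed.

Lemma fgenS m : fgen m.+1 = theta_ext riccati (fgen m).
Proof.
apply/polyP => i; rewrite coef_fgen f_rec -!coef_fgen coefD coef_map -addrA.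
congr (_ + _); rewrite mulrBr coefB mulrA coefMC coefMX coefMXn !scaler_nat.
case: i => [|[|i]] /=; rewrite ?coef_deriv; first by rewrite !mulr0n mul0r.
  by rewrite !mulr1n mulr0n mulrC.
by rewrite subn2 /= mulrnAl mulrC.
Qed.

Lemma reflection_fgen m : reflection (fgen m) = fgen m.
Proof.
elim: m => [|m IHm]; last by rewrite fgenS reflection_theta_ext IHm.
rewrite fgen0 rmorphD /= reflectionX reflectionC -addrA -polyCD.
congr (_ + _%:P).
rewrite comp_polyB comp_polyZ comp_polyX -polyC1 comp_polyC scalerN addrA.
by congr (_ - _); rewrite -[X in X - _]scale1r -scalerBl.
Qed.

Lemma tdeg_fgen m : tdeg_le m.+1 (fgen m).
Proof.
elim: m => [|m IHm] i j; rewrite coef_fgen.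
  by case: i => [|[|i]]; case: j => [|[|j]] //= _; rewrite !coefE ?mulr0 ?subr0.
move=> ij; rewrite f_rec coefB coefD coef_theta !coefZ mulrBl mul1r coefB.
rewrite coefXM -!coef_fgen !IHm; [|lia..].
case: i ij => [|i] ij; case: j ij => [|j] ij /=;
  rewrite ?IHm ?mulr0 ?mul0r ?subr0 ?addr0 //; lia.
Qed.

Lemma fgen_lead m : (fgen m)`_m.+1 = ((-1) ^+ m * m`!%:R)%:P.
Proof. by rewrite coef_fgen f_diag. Qed.

Lemma fsumE n (m : 'I_n -> nat) i : fsum m i = (\prod_(j < n) fgen (m j))`_i.
Proof.
rewrite coef_prod /fsum big_mkcondr; apply: eq_bigr => c _.
under [RHS]eq_bigr do rewrite coef_fgen.
case: ifPn => // /forallPn[j]; rewrite -ltnNge => mj.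
by rewrite (bigD1 j) //= f_gt_eq0 // mul0r.
Qed.

Lemma Amx_trig K : is_trig_mx (Amx K).
Proof. by apply/is_trig_mxP => i j ij; rewrite mxE leqNgt ij. Qed.

Lemma horner_riccati h : riccati.[h] = (1 - 'X) * h - h ^+ 2.
Proof. by rewrite /riccati !hornerE mulrC. Qed.

Lemma fgen0_horner_bern N : (fgen 0).[bern_poly N] = even_bern_poly N - 1.
Proof. by rewrite fgen0 hornerD hornerX hornerC addrA. Qed.

Lemma fgen_horner_bern N e : take_poly N (fgen e).[bern_poly N] =
  take_poly N (iter e theta (fgen 0).[bern_poly N]).
Proof.
elim: e => [//|e IHe]; rewrite fgenS -theta_horner; last first.
  by rewrite horner_riccati theta_bern_poly.
by rewrite take_poly_theta IHe -take_poly_theta.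
Qed.

(* The variable stands for t^2. *)
Definition bern_power_poly (k e : nat) : {poly rat} :=
  \poly_(i < k.+1) ((i != 0%N)%:R * ((2 * i)%:R ^+ e * bern (2 * i))).

Lemma fgen_horner_bern_even k e :
  take_poly (2 * k).+1 (fgen e).[bern_poly (2 * k).+1] =
  take_poly (2 * k).+1 (bern_power_poly k e \Po 'X^2).
Proof.
apply/polyP => i; rewrite fgen_horner_bern !coef_take_poly; case: ltnP => // ik.
rewrite coef_iter_theta fgen0_horner_bern coefB coef1 coef_even_bern_poly //.
rewrite coef_comp_poly_Xn //; case: ifPn => [/dvdnP[q]|].
  rewrite mulnC => iE; rewrite {}iE mulKn // in ik *.
  rewrite coef_poly ifT; last by lia.
  case: q ik => [|q] ik; first by rewrite even_bernE // bern0 subrr mulr0 mul0r.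
  by rewrite even_bernE ?subr0 ?mul1r //; lia.
rewrite dvdn2 negbK => odd_i; rewrite even_bern_odd // gtn_eqF ?odd_gt0 //.
by rewrite subr0 mulr0.
Qed.

Section ProductExpansion.
Variables (n : nat) (m : 'I_n -> nat).
Local Notation N := (\sum_(j < n) m j + n)%N.
Local Notation T := (maxn ((N - 2) %/ 2) ((n - 1) %/ 2)).

Lemma sum_F_f i : (0 < i <= N)%N -> \sum_(j < N) F_ m j.+1 * f_ j i = fsum m i.
Proof.
rewrite /F_; case: N => [|K]; first by case: i.
case: i => // i /= iK.
pose v : 'rV[{poly rat}]_K.+1 := \row_c fsum m c.+1.
pose w := v *m invmx (Amx K).
have wE (j : 'I_K.+1) :
    w 0 j = \sum_(j.+1 <= a < K.+2) fsum m a * g_ K a.-1 j.+1.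
  rewrite big_add1 /= mxE.
  transitivity (\sum_(0 <= a < K.+1) fsum m a.+1 * g_ K a j.+1).
    by rewrite big_mkord; apply: eq_bigr => c _; rewrite mxE /g_ !inord_val.
  rewrite (@big_cat_nat _ _ _ j) ?(ltnW (ltn_ord j)) //= big_nat big1 ?add0r //.
  have /is_trig_mxP inv_upper0 := invmx_trig (Amx_unit K) (Amx_trig K).
  move=> a /andP[_ aj].
  by rewrite /g_ /= inord_val inv_upper0 ?mulr0 // inordK // (ltn_trans aj).
have /matrixP/(_ 0 (inord i)) : w *m Amx K = v by rewrite mulmxKV ?Amx_unit.
rewrite !mxE inordK // => <-; apply: eq_bigr => j _.
rewrite -wE [Amx K _ _]mxE inordK //; case: leqP => // ji.
by rewrite f_gt_eq0.
Qed.

Definition prod_fgen_const : {poly rat} :=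
  fsum m 0 - \sum_(j < N) F_ m j.+1 * f_ j 0.

Lemma tdeg_prod_fgen : tdeg_le N (\prod_(j < n) fgen (m j)).
Proof.
rewrite -sum_ord_succn.
by apply: tdeg_le_prod => j; exact: (@tdeg_fgen (m j)).
Qed.

Lemma prod_fgen : \prod_(j < n) fgen (m j) =
  tri_comb fgen N prod_fgen_const (fun j => F_ m j.+1).
Proof.
apply/polyP => i; rewrite coefD coefC coef_sum.
under [X in _ + X]eq_bigr do rewrite coefCM coef_fgen.
case: i => [|i] /=; first by rewrite subrK fsumE.
rewrite add0r; have [iN|Ni] := leqP i.+1 N; first by rewrite sum_F_f // fsumE.
rewrite [RHS]big1 => [|j _]; last first.
  by rewrite f_gt_eq0 ?mulr0 // ltnS (leq_trans (ltn_ord j)).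
by apply/polyP => j; rewrite tdeg_prod_fgen ?coef0 //; lia.
Qed.

Lemma prod_fgen_coef_even : prod_fgen_const \Po - 'X = prod_fgen_const /\
  forall j, (j < N)%N -> F_ m j.+1 \Po - 'X = F_ m j.+1.
Proof.
apply: (tri_comb_fixed f_diag_neq0 fgen_lead (@tdeg_fgen)
  (s := reflection) (s0 := comp_poly (- 'X)) reflectionC reflection_fgen).
rewrite -prod_fgen rmorph_prod.
by apply: eq_bigr => j _; exact: reflection_fgen.
Qed.

Lemma F_coef_eq0 j i : (j < N)%N -> (N < i + j.+1)%N -> (F_ m j.+1)`_i = 0.
Proof.
apply: (tri_comb_tdeg f_diag_neq0 fgen_lead (@tdeg_fgen)
  (a := fun j => F_ m j.+1) (c := prod_fgen_const)).
by rewrite -prod_fgen; exact: tdeg_prod_fgen.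
Qed.

Lemma coef_fsum0 i : (n < i)%N -> (fsum m 0)`_i = 0.
Proof.
move=> ni; rewrite fsumE coef0_prod.
have fm0_tdeg (j : 'I_n) : tdeg_le 1 ((fgen (m j))`_0)%:P.
  apply: tdeg_leC => k.
  rewrite coef_fgen f_col0 coefB coefZ coefX -polyC_natr coefC.
  by case: k => [|[|k]] //= _; rewrite mulr0 subr0.
have := @tdeg_le_prod _ _ (index_enum 'I_n) _ _ fm0_tdeg 0%N i.
by rewrite sum1_card card_ord -rmorph_prod coefC; apply.
Qed.

Hypothesis n_gt0 : (0 < n)%N.

Let N_gt0 : (0 < N)%N.
Proof. by rewrite addn_gt0 n_gt0 orbT. Qed.

Lemma prod_fgen_constE :
  prod_fgen_const = fsum m 0 + F_ m 1 - (2^-1 *: \sum_(j < N) F_ m j.+1) * 'X.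
Proof.
rewrite /prod_fgen_const -addrA; congr (_ + _).
under eq_bigr do rewrite f_col0 mulrBr.
rewrite sumrB opprB; congr (_ - _).
  rewrite (sum_ord_head (f := fun j => F_ m j.+1 * (j == 0%N)%:R)) ?mulr1 //.
  by move=> j /andP[j_gt0 _]; rewrite gtn_eqF ?mulr0.
by rewrite -mulr_suml -scalerAr scalerAl; congr (_ *: _ * _).
Qed.

Lemma coef_prod_fgen_constS i : prod_fgen_const`_i.+1 =
  (fsum m 0)`_i.+1 + (F_ m 1)`_i.+1 - 2^-1 * \sum_(j < N) (F_ m j.+1)`_i.
Proof.
rewrite prod_fgen_constE coefB coefD coefMX coefZ; congr (_ - _ * _).
exact: coef_sum.
Qed.

Lemma coef_prod_fgen_const_double k :
  (n < 2 * k)%N -> prod_fgen_const`_(2 * k) = a_ m 1 k.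
Proof.
move=> nk; have k_gt0 : (0 < k)%N by lia.
have kE : (2 * k = (2 * k).-1.+1)%N by lia.
rewrite /a_ kE coef_prod_fgen_constS -kE coef_fsum0 // add0r.
rewrite big1 ?mulr0 ?subr0 // => j _.
by apply: coef_odd_eq0; [have [_ ->] := prod_fgen_coef_even|lia].
Qed.

(* Otherwise the odd coefficient of index N of the constant term survives. *)
Lemma F1_subtop_coef_eq0 : (0 < \sum_(j < n) m j)%N -> odd N ->
  (F_ m 1)`_N.-1 = 0.
Proof.
move=> M_gt0 odd_N; have [C_even _] := prod_fgen_coef_even.
have := coef_odd_eq0 C_even odd_N.
rewrite -[X in prod_fgen_const`_X](prednK N_gt0).
rewrite coef_prod_fgen_constS prednK //.
rewrite coef_fsum0 ?add0r ?(F_coef_eq0 (i := N) N_gt0) ?add0r; [|lia..].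
rewrite (sum_ord_head (f := fun j => (F_ m j.+1)`_N.-1)) //; last first.
  move=> j /andP[j_gt0 jN]; rewrite F_coef_eq0 //.
  by rewrite -addSnnS prednK // -[ltnLHS]addn0 ltn_add2l.
by move=> /eqP; rewrite oppr_eq0 mulf_eq0 invr_eq0 => /eqP.
Qed.

Lemma a_eq0 j l : (j < N)%N ->
  (T < l)%N || (N - 2 * l <= j)%N -> a_ m j.+1 l = 0.
Proof.
move=> jN jl; have [lt_N|le_N] := ltnP N (2 * l + j.+1).
  exact: F_coef_eq0.
have j0 : j = 0%N by lia.
rewrite j0 /a_; have -> : (2 * l = N.-1)%N by lia.
by apply: F1_subtop_coef_eq0; lia.
Qed.

Variable k : nat.
Hypothesis le_nk : (n <= k)%N.
Local Notation F_term l j :=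
  (a_ m j.+1 l * ((2 * (k - l))%:R ^+ j * bern (2 * (k - l)))).

Lemma prod_bern_power_poly :
  take_poly (2 * k).+1 ((\prod_(j < n) bern_power_poly k (m j)) \Po 'X^2) =
  take_poly (2 * k).+1
    (prod_fgen_const + \sum_(j < N) F_ m j.+1 * (bern_power_poly k j \Po 'X^2)).
Proof.
rewrite rmorph_prod /=.
transitivity (take_poly (2 * k).+1
    (\prod_(j < n) (fgen (m j)).[bern_poly (2 * k).+1])).
  by apply: eq_take_poly_prod => j; rewrite fgen_horner_bern_even.
rewrite -horner_prod prod_fgen hornerD hornerC horner_sum !take_polyD.
congr (_ + _); rewrite !take_poly_sum; apply: eq_bigr => j _.
rewrite hornerM hornerC; apply: eq_take_polyM => //.
exact: fgen_horner_bern_even.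
Qed.

Lemma coef_prod_bern_power_poly : (\prod_(j < n) bern_power_poly k (m j))`_k =
  \sum_(c : {ffun 'I_n -> 'I_k.+1} |
          (\sum_(j < n) c j == k)%N && [forall j, (1 <= c j)%N])
     \prod_(j < n) ((2 * c j)%:R ^+ m j * bern (2 * c j)).
Proof.
rewrite coef_prod [RHS]big_mkcondr; apply: eq_bigr => c _.
case: ifPn => [/forallP c_gt0|/forallPn[j]].
  by apply: eq_bigr => j _; rewrite coef_poly ltn_ord -lt0n c_gt0 mul1r.
rewrite -leqNgt leqn0 => /eqP cj0.
by rewrite (bigD1 j) //= coef_poly ltn_ord cj0 !mul0r.
Qed.

Lemma coef_prod_bern_power_poly_F :
  (\prod_(j < n) bern_power_poly k (m j))`_k =
  \sum_(l < k.+1) \sum_(j < N) F_term l j.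
Proof.
have /polyP/(_ (2 * k)%N) := prod_bern_power_poly.
rewrite !coef_take_poly ltnSn coef_comp_poly_Xn // dvdn_mulr // mulKn // => ->.
rewrite coefD coef_sum coef_prod_fgen_const_double //; last by lia.
under eq_bigr do rewrite coefM_comp_X2.
rewrite exchange_big big_ord_recr [RHS]big_ord_recr /= addrCA; congr (_ + _).
  apply: eq_bigr => l _; apply: eq_bigr => j _; have lk := ltn_ord l.
  by rewrite coef_poly ifT ?gtn_eqF ?mul1r //; lia.
rewrite subnn muln0 bern0 big1 => [|j _]; last first.
  by rewrite coef_poly !mul0r mulr0.
rewrite addr0 (sum_ord_head (f := fun j => a_ m j.+1 k * (0 ^+ j * 1))) //.
  by rewrite !mulr1.
by move=> j /andP[j_gt0 _]; rewrite expr0n gtn_eqF // mul0r mulr0.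
Qed.

Lemma coef_prod_bern_power_poly_F_trunc :
  (\prod_(j < n) bern_power_poly k (m j))`_k =
  \sum_(l < (minn T k).+1) \sum_(j < N - 2 * l) F_term l j.
Proof.
rewrite coef_prod_bern_power_poly_F.
rewrite (sum_ord_narrow (f := fun l => \sum_(j < N) F_term l j)
           (b := (minn T k).+1)); last 2 first.
- by rewrite ltnS geq_minr.
- move=> l; rewrite gtn_min ltnS => /andP[/orP[Tl _|]]; last by case: ltnP.
  by rewrite big1 // => j _; rewrite a_eq0 ?mul0r // Tl.
apply: eq_bigr => l _.
apply: (sum_ord_narrow (f := fun j => F_term l j)); first exact: leq_subr.
by move=> j /andP[jl jN]; rewrite a_eq0 ?mul0r // jl orbT.
Qed.

End ProductExpansion.

(** * Euler's formula and the weighted sum formula *)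

Section ZetaEven.
Variable R : realType.

(* This is (2 pi i)^2, since zeta(2) = pi^2 / 6. *)
Definition euler_const : R := - 24 * zeta R 2.

Lemma zeta_even k :
  zeta R (2 * k) = - (euler_const ^+ k * ratr (bern (2 * k)) / 2).
Proof.
elim/ltn_ind: k => -[|[|q]] IH.
- by rewrite muln0 bern0 rmorph1 expr0 /zeta eqxx; field.
- by rewrite muln1 bern2 fmorphV rmorph_nat expr1 /euler_const; field.
have coef_neq0 : q.+1%:R + 3 / 2 != 0 :> R by rewrite gt_eqF // addr_gt0.
apply: (mulfI coef_neq0); rewrite -zeta_conv //.
transitivity (euler_const ^+ q.+2 / 4 *
    ratr (\sum_(j < q.+1) bern (2 * j.+1) * bern (2 * (q.+1 - j)))).
  rewrite rmorph_sum mulr_sumr; apply: eq_bigr => j _; have jq := ltn_ord j.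
  rewrite !IH; [|lia..].
  have -> : (q.+2 = j.+1 + (q.+1 - j))%N by lia.
  by rewrite exprD [in RHS]rmorphM /=; field.
rewrite bern_conv // rmorphM rmorphN rmorph_nat /=.
have -> : (2 * q.+2).+1%:R = 2 * (q.+1%:R + 3 / 2) :> R.
  by rewrite -natr1 natrM -[q.+2%:R]natr1; field.
by field.
Qed.

Lemma bern_even_neq0 k : ratr (bern (2 * k)) != 0 :> R.
Proof.
have : zeta R (2 * k) != 0.
  case: k => [|k].
    by rewrite muln0 /zeta eqxx oppr_eq0 invr_eq0 pnatr_eq0.
  by rewrite gt_eqF // (lt_le_trans ltr01) // zeta_ge1 //; lia.
by apply: contraNneq => bern_eq0; rewrite zeta_even bern_eq0 mulr0 mul0r oppr0.
Qed.

Lemma zeta_even_mul k l : (l <= k)%N ->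
  ratr ((2 * l)`!%:R / bernoulli_num (2 * l)) * zeta R (2 * l)
    * zeta R (2 * k - 2 * l) =
  euler_const ^+ k * ratr (bern (2 * (k - l))) / 4.
Proof.
move=> lk; have -> : (2 * l)`!%:R / bernoulli_num (2 * l) = (bern (2 * l))^-1.
  by rewrite /bern invf_div.
rewrite -mulnBr !zeta_even fmorphV -[in RHS](subnKC lk) exprD addKn.
by field; exact: bern_even_neq0.
Qed.

Lemma prod_zeta_even n k (m c : 'I_n -> nat) : (\sum_(j < n) c j = k)%N ->
  (\prod_(j < n) (c j)%:R ^+ m j) * (\prod_(j < n) zeta R (2 * c j)) =
  (-1) ^+ n * (euler_const ^+ k / 2 ^+ (\sum_(j < n) m j + n)
    * ratr (\prod_(j < n) ((2 * c j)%:R ^+ m j * bern (2 * c j)))).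
Proof.
move=> ck; rewrite -big_split mulrA rmorph_prod /=.
have -> : (-1) ^+ n * (euler_const ^+ k / 2 ^+ (\sum_(j < n) m j + n)) =
    \prod_(j < n) (- (euler_const ^+ c j / 2 ^+ (m j).+1)).
  rewrite prodrN card_ord big_split /= prodrXr ck prodfV prodrXr.
  by rewrite sum_ord_succn.
rewrite -big_split; apply: eq_bigr => j _ /=.
rewrite zeta_even [in RHS]rmorphM rmorphXn rmorph_nat.
rewrite natrM (exprMn (m j) 2) exprS.
by field; rewrite expf_neq0.
Qed.

Lemma zeta_even_mul_sum k l w b (a : nat -> rat) : (l <= k)%N ->
  ratr ((2 * l)`!%:R / bernoulli_num (2 * l))
    * (\sum_(1 <= j < b.+1)
         ratr (a j) / 2 ^ (w%:Z - j%:Z - 1) * (k - l)%:R ^+ (j - 1))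
    * zeta R (2 * l) * zeta R (2 * k - 2 * l) =
  euler_const ^+ k / 2 ^+ w
    * ratr (\sum_(j < b) a j.+1 * ((2 * (k - l))%:R ^+ j * bern (2 * (k - l)))).
Proof.
move=> lk; set S := \sum_(1 <= j < b.+1) _.
rewrite [_ * S * _]mulrAC [LHS]mulrAC zeta_even_mul // {}/S big_add1 big_mkord.
rewrite rmorph_sum !mulr_sumr; apply: eq_bigr => j _; rewrite subn1 /=.
have -> : (2 : R) ^ (w%:Z - j.+1%:Z - 1) = 2 ^+ w / (2 ^+ j * 4).
  have -> : w%:Z - j.+1%:Z - 1 = w%:Z - (j + 2)%:Z by lia.
  by rewrite expfzDr // -exprnP -exprnN exprD -(natrX _ 2 2).
rewrite [in RHS]rmorphM (rmorphM _ (_ ^+ _)) rmorphXn rmorph_nat.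
rewrite natrM (exprMn j 2) /=.
by field; rewrite !expf_neq0.
Qed.

End ZetaEven.

Theorem theorem3p1 (R : realType) (n k : nat) (m : 'I_n -> nat)
    (hn : (0 < n)%N) (hk : (n <= k)%N) :
  let M := (\sum_(j < n) m j)%N in
  let T := maxn ((M + n - 2) %/ 2) ((n - 1) %/ 2) in
  \sum_(c : {ffun 'I_n -> 'I_k.+1} |
          (\sum_(j < n) c j == k)%N && [forall j, (1 <= c j)%N])
     (\prod_(j < n) (c j)%:R ^+ m j) * (\prod_(j < n) zeta R (2 * c j))
  = (-1) ^+ n *
    \sum_(0 <= l < (minn T k).+1)
       (ratr ((2 * l)`!%:R / bernoulli_num (2 * l)) : R)
       * (\sum_(1 <= j < (M + n - 2 * l).+1)
            (ratr (a_ m j l) : R) / 2 ^ ((M + n)%:Z - j%:Z - 1)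
            * (k - l)%:R ^+ (j - 1))
       * zeta R (2 * l) * zeta R (2 * k - 2 * l).
Proof.
move=> M T.
under eq_bigr => c /andP[/eqP ck _] do rewrite (prod_zeta_even R m ck).
rewrite -!mulr_sumr -rmorph_sum -coef_prod_bern_power_poly.
rewrite coef_prod_bern_power_poly_F_trunc // -/M -/T.
rewrite rmorph_sum mulr_sumr big_mkord; congr (_ * _).
apply: eq_bigr => l _; rewrite zeta_even_mul_sum //.
by have := ltn_ord l; rewrite ltnS leq_min => /andP[].
Qed.
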